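(* The introduction of the probing noise functions $e_{uk}$ and $e_{vk}$ does not cause any bias when estimating the matrices $H_1^{(i)}$ and $H_2^{(i)}$ in the Q-functions at each step. That is, if $\hat H_1^{(i)},\hat H_2^{(i)}$ denote the matrices estimated with probing noise and $H_1^{(i)},H_2^{(i)}$ the matrices of the noise-free Q-learning iteration (both defined in the context, with the same initialization), then $$\hat H_1^{(i)}=H_1^{(i)},\qquad \hat H_2^{(i)}=H_2^{(i)}\qquad\text{for all } i\ge 0 .$$
   Context: System: $x_{k+1}=A_1x_k+B_1u_k+C_1v_k+(A_2x_k+C_2v_k)\omega_k$, $k\in\{0,1,2,\dots\}$, with deterministic $x_0$, $x_k\in\mathbb{R}^n$, control $u_k\in\mathbb{R}^{m_1}$, disturbance $v_k\in\mathbb{R}^{m_2}$, constant real matrices $A_1,A_2\in\mathbb{R}^{n\times n}$, $B_1\in\mathbb{R}^{n\times m_1}$, $C_1,C_2\in\mathbb{R}^{n\times m_2}$, and $(\omega_k)$ an independent scalar white noise sequence with $E\omega_k=0$, $E(\omega_s\omega_k)=\delta_{sk}$. The output is $y_k=\begin{bmatrix}Cx_k\\ Du_k\end{bmatrix}$ with $D^TD=I$, $Q=C^TC$, and $\gamma>0$ is fixed. Stage costs: $r_1(x,u,v)=E(\gamma^2v^Tv-x^TQx-u^Tu)$, $r_2(x,u,v)=E(x^TQx+u^Tu)$. Noise-free Q-learning iteration. Put $p=n+m_1+m_2$ and $z=(x^T,u^T,v^T)^T$. For $j=1,2$, $Q_j^{(i)}(x,u,v)=E(z^TH_j^{(i)}z)$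 with $H_j^{(i)}\in\mathbb{R}^{p\times p}$ symmetric, partitioned into blocks $\Gamma_j^{(i)}(a,b)$, $a,b\in\{1,2,3\}$, conforming to $(n,m_1,m_2)$. Start from $H_1^{(0)}=H_2^{(0)}=0$ and given initial gains $K_1^{(0)},K_2^{(0)}$. For each $i\ge0$: (a) $P_j^{(i)}=\begin{bmatrix}I&K_2^{(i)T}&K_1^{(i)T}\end{bmatrix}H_j^{(i)}\begin{bmatrix}I&K_2^{(i)T}&K_1^{(i)T}\end{bmatrix}^T$; (b) $H_j^{(i+1)}$ is determined by $Q_j^{(i+1)}(x_k,u_k,v_k)=r_j(x_k,u_k,v_k)+E(x_{k+1}^TP_j^{(i)}x_{k+1})$, where $x_{k+1}$ is the successor of $x_k$ under $u_k,v_k$, understood as an identity of quadratic forms in $(x_k,u_k,v_k)$; (c) $\begin{bmatrix}K_1^{(i+1)}\\ K_2^{(i+1)}\end{bmatrix}=-\begin{bmatrix}\Gamma_1^{(i+1)}(3,3)&\Gamma_1^{(i+1)}(2,3)^T\\ \Gamma_2^{(i+1)}(2,3)&\Gamma_2^{(i+1)}(2,2)\end{bmatrix}^{-1}\begin{bmatrix}\Gamma_1^{(i+1)}(1,3)^T\\ \Gamma_2^{(i+1)}(1,2)^T\end{bmatrix}$ (the inverse is presupposed to exist). Estimation with probing noise. The probing noises $e_{uk}\in\mathbb{R}^{m_1}$, $e_{vk}\in\mathbb{R}^{m_2}$ are deterministic functions of time $k$ (e.g. trigonometric functions). Start from $\hat H_j^{(0)}=0$ and $\hat K_j^{(0)}=K_j^{(0)}$.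 At iteration $i$ one applies to the system the inputs $\hat u_k^{(i)}=\hat K_2^{(i)}x_k+e_{uk}$, $\hat v_k^{(i)}=\hat K_1^{(i)}x_k+e_{vk}$ over a window of times $k,k+1,\dots,k+N$. At each time $t$ in the window put $\hat z_t=(x_t^T,\hat u_t^{(i)T},\hat v_t^{(i)T})^T$, $\hat{\mathcal Z}_t=E(\hat z_t\hat z_t^T)$, and $$d_j(\hat z_t,\hat H_j^{(i)})=r_j(x_t,\hat u_t^{(i)},\hat v_t^{(i)})+E(z_{t+1}^T\hat H_j^{(i)}z_{t+1}),\qquad z_{t+1}=\begin{bmatrix}x_{t+1}\\ \hat K_2^{(i)}x_{t+1}\\ \hat K_1^{(i)}x_{t+1}\end{bmatrix},$$ where $x_{t+1}$ is the successor of $x_t$ under $\hat u_t^{(i)},\hat v_t^{(i)}$. For symmetric $H$, $vecs(H)\in\mathbb{R}^{p(p+1)/2}$ lists the entries $H_{ab}$, $a\le b$, row by row; for symmetric $\mathcal Z$, $vech(\mathcal Z)$ is the row vector listing, in the same order, $\mathcal Z_{aa}$ and $2\mathcal Z_{ab}$ ($a<b$), so that $Tr(\mathcal ZH)=vech(\mathcal Z)vecs(H)$. Let $X$ be the matrix whose rows are $vech(\hat{\mathcal Z}_t)$ and $Y_j$ the column vector of the $d_j(\hat z_t,\hat H_j^{(i)})$, for $t=k,\dots,k+N$; the excitation is assumed to make $X$ of full column rank. Then $\hat H_j^{(i+1)}$ is the symmetric matrix with $vecs(\hat H_j^{(i+1)})=(X^TX)^{-1}X^TY_j$, and $\hat K_1^{(i+1)},\hat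 K_2^{(i+1)}$ are obtained from $\hat H_1^{(i+1)},\hat H_2^{(i+1)}$ by the formula in (c). Expectations are exact (no sampling error). *)

(* Defs.v *)
From HB Require Import structures.
From mathcomp Require Import all_boot all_order all_algebra.
From mathcomp Require Import zify ring.
From mathcomp Require Import all_classical all_reals all_analysis.

Set Implicit Arguments.
Unset Strict Implicit.
Unset Printing Implicit Defensive.

Import Order.TTheory GRing.Theory Num.Theory.
Local Open Scope classical_set_scope.
Local Open Scope ring_scope.

(* Data of
     x_{k+1} = A1 x_k + B1 u_k + C1 v_k + (A2 x_k + C2 v_k) omega_k,
     y_k = [C x_k ; D u_k].
   Random vectors are functions on the sample space T, with values in 'cV[R]_m;
   a deterministic vector is a constant function. *)
Record plant (R : realType) (n m1 m2 q1 q2 : nat) := Plant {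
  A1 : 'M[R]_n;
  A2 : 'M[R]_n;
  B1 : 'M[R]_(n, m1);
  C1 : 'M[R]_(n, m2);
  C2 : 'M[R]_(n, m2);
  Cout : 'M[R]_(q1, n);
  Dout : 'M[R]_(q2, m1) }.

Definition Qmx (R : realType) (n m1 m2 q1 q2 : nat)
    (S : plant R n m1 m2 q1 q2) : 'M[R]_n := (Cout S)^T *m Cout S.

(* The state following x under the inputs u, v and the noise value om. *)
Definition successor (R : realType) (n m1 m2 q1 q2 : nat)
    (S : plant R n m1 m2 q1 q2) (T : Type) (om : T -> R)
    (x : T -> 'cV[R]_n) (u : T -> 'cV[R]_m1) (v : T -> 'cV[R]_m2)
    : T -> 'cV[R]_n :=
  fun w => A1 S *m x w + B1 S *m u w + C1 S *m v w
           + om w *: (A2 S *m x w + C2 S *m v w).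

(* Real-valued expectation; as usual, it carries its meaning only for
   integrable X. *)
Definition mean d (T : measurableType d) (R : realType) (P : probability T R)
    (X : T -> R) : R := fine ('E_P[X])%E.

(* Mutual independence: the product rule for every finite subfamily. *)
Definition mutually_independent d (T : measurableType d) (R : realType)
    (P : probability T R) (X : nat -> {RV P >-> R}) : Prop :=
  forall (J : seq nat) (B : nat -> set R), uniq J ->
    (forall j, measurable (B j)) ->
    P (\bigcap_(j in [set` J]) (X j @^-1` B j))
      = (\prod_(j <- J) P (X j @^-1` B j))%E.

Definition white_noise d (T : measurableType d) (R : realType)
    (P : probability T R) (omega : nat -> {RV P >-> R}) : Prop :=
  [/\ mutually_independent omega,
      forall k, ('E_P[omega k] = 0)%E &
      forall s k, ('E_P[(fun w => omega s w * omega k w)%R]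
                   = ((s == k)%:R : R)%:E)%E].

(* Events determined by omega_0, ..., omega_(t-1). *)
Definition past d (T : measurableType d) (R : realType) (P : probability T R)
    (omega : nat -> {RV P >-> R}) (t : nat) : set (set T) :=
  <<s [set A | exists s (B : set R),
         [/\ (s < t)%N, measurable B & A = omega s @^-1` B]] >>.

(* An input at time t which may depend on the noise up to time t - 1 only
   and has finite second moments. *)
Definition admissible d (T : measurableType d) (R : realType)
    (P : probability T R) (omega : nat -> {RV P >-> R}) (t m : nat)
    (y : T -> 'cV[R]_m) : Prop :=
  forall a : 'I_m,
    (forall B : set R, measurable B ->
       past omega t ((fun w => y w a 0) @^-1` B)) /\
    ('E_P[(fun w => (y w a 0) ^+ 2)%R] < +oo)%E.

Definition quad (R : realType) (m : nat) (M : 'M[R]_m) (z : 'cV[R]_m) : R :=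
  (z^T *m M *m z) 0 0.

Definition r1 (R : realType) (n m1 m2 q1 q2 : nat)
    (S : plant R n m1 m2 q1 q2) (gamma : R)
    d (T : measurableType d) (P : probability T R)
    (x : T -> 'cV[R]_n) (u : T -> 'cV[R]_m1) (v : T -> 'cV[R]_m2) : R :=
  mean P (fun w => gamma ^+ 2 * ((v w)^T *m v w) 0 0
                   - quad (Qmx S) (x w) - ((u w)^T *m u w) 0 0).

Definition r2 (R : realType) (n m1 m2 q1 q2 : nat)
    (S : plant R n m1 m2 q1 q2)
    d (T : measurableType d) (P : probability T R)
    (x : T -> 'cV[R]_n) (u : T -> 'cV[R]_m1) (v : T -> 'cV[R]_m2) : R :=
  mean P (fun w => quad (Qmx S) (x w) + ((u w)^T *m u w) 0 0).

Definition stack (R : realType) (n m1 m2 : nat)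
    (x : 'cV[R]_n) (u : 'cV[R]_m1) (v : 'cV[R]_m2) : 'cV[R]_(n + m1 + m2) :=
  col_mx (col_mx x u) v.

Definition Qfun (R : realType) (n m1 m2 : nat)
    d (T : measurableType d) (P : probability T R)
    (H : 'M[R]_(n + m1 + m2))
    (x : T -> 'cV[R]_n) (u : T -> 'cV[R]_m1) (v : T -> 'cV[R]_m2) : R :=
  mean P (fun w => quad H (stack (x w) (u w) (v w))).

(* Blocks Gamma(a, b) of H with respect to (n, m1, m2). *)
Section Blocks.
Context {R : realType} {n m1 m2 : nat}.
Implicit Type H : 'M[R]_(n + m1 + m2).
Definition Gamma12 H : 'M[R]_(n, m1) := ursubmx (ulsubmx H).
Definition Gamma22 H : 'M[R]_m1 := drsubmx (ulsubmx H).
Definition Gamma13 H : 'M[R]_(n, m2) := usubmx (ursubmx H).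
Definition Gamma23 H : 'M[R]_(m1, m2) := dsubmx (ursubmx H).
Definition Gamma33 H : 'M[R]_m2 := drsubmx H.
End Blocks.

(* Gains: v = K1 x and u = K2 x. *)
Definition value_mx (R : realType) (n m1 m2 : nat)
    (K1 : 'M[R]_(m2, n)) (K2 : 'M[R]_(m1, n)) (H : 'M[R]_(n + m1 + m2))
    : 'M[R]_n :=
  let L := row_mx (row_mx 1%:M K2^T) K1^T in L *m H *m L^T.

Definition gain_mx (R : realType) (n m1 m2 : nat)
    (H1 H2 : 'M[R]_(n + m1 + m2)) : 'M[R]_(m2 + m1) :=
  block_mx (Gamma33 H1) (Gamma23 H1)^T
           (Gamma23 H2) (Gamma22 H2).

(* invmx is a total function, so the existence of the inverse is explicit. *)
Definition gain_update (R : realType) (n m1 m2 : nat)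
    (H1 H2 : 'M[R]_(n + m1 + m2))
    (K1 : 'M[R]_(m2, n)) (K2 : 'M[R]_(m1, n)) : Prop :=
  gain_mx H1 H2 \in unitmx /\
  col_mx K1 K2
    = - (invmx (gain_mx H1 H2) *m col_mx (Gamma13 H1)^T (Gamma12 H2)^T).

(* Identity of quadratic forms: it is required at all deterministic
   (x, u, v); only the noise is averaged. *)
Definition bellman_update (R : realType) (n m1 m2 q1 q2 : nat)
    (S : plant R n m1 m2 q1 q2)
    d (T : measurableType d) (P : probability T R)
    (omega : nat -> {RV P >-> R})
    (r : (T -> 'cV[R]_n) -> (T -> 'cV[R]_m1) -> (T -> 'cV[R]_m2) -> R)
    (Pm : 'M[R]_n) (H : 'M[R]_(n + m1 + m2)) : Prop :=
  H^T = H /\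
  forall (k : nat) (x0 : 'cV[R]_n) (u0 : 'cV[R]_m1) (v0 : 'cV[R]_m2),
    let x := fun _ : T => x0 in
    let u := fun _ : T => u0 in
    let v := fun _ : T => v0 in
    Qfun P H x u v
      = r x u v + mean P (fun w => quad Pm (successor S (omega k) x u v w)).

Record noise_free_iteration (R : realType) (n m1 m2 q1 q2 : nat)
    (S : plant R n m1 m2 q1 q2) (gamma : R)
    d (T : measurableType d) (P : probability T R)
    (omega : nat -> {RV P >-> R})
    (K1_0 : 'M[R]_(m2, n)) (K2_0 : 'M[R]_(m1, n))
    (H1 H2 : nat -> 'M[R]_(n + m1 + m2))
    (K1 : nat -> 'M[R]_(m2, n)) (K2 : nat -> 'M[R]_(m1, n)) : Prop := {
  nf_H1_0 : H1 0%N = 0;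
  nf_H2_0 : H2 0%N = 0;
  nf_K1_0 : K1 0%N = K1_0;
  nf_K2_0 : K2 0%N = K2_0;
  nf_H1 : forall i, bellman_update S omega (r1 S gamma P)
                      (value_mx (K1 i) (K2 i) (H1 i)) (H1 i.+1);
  nf_H2 : forall i, bellman_update S omega (r2 S P)
                      (value_mx (K1 i) (K2 i) (H2 i)) (H2 i.+1);
  nf_K : forall i, gain_update (H1 i.+1) (H2 i.+1) (K1 i.+1) (K2 i.+1) }.

(* Positions (a, b), a <= b.  The enumeration of 'I_p * 'I_p is lexicographic,
   so enum_val lists these positions row by row. *)
Definition upper (p : nat) : {pred 'I_p * 'I_p} :=
  [pred ab : 'I_p * 'I_p | (ab.1 <= ab.2)%N].
Arguments upper : clear implicits.

Definition vecs (R : realType) (p : nat) (H : 'M[R]_p) : 'cV[R]_#|upper p| :=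
  \col_(l < #|upper p|) H (enum_val l).1 (enum_val l).2.

Definition vech (R : realType) (p : nat) (Z : 'M[R]_p) : 'rV[R]_#|upper p| :=
  \row_(l < #|upper p|)
    (let: (a, b) := enum_val l in if a == b then Z a b else 2 * Z a b).

Lemma card_upper (p : nat) : #|upper p| = ((p * p.+1) %/ 2)%N.
Proof.
rewrite -sum1_card -(pair_big_dep xpredT (fun a b : 'I_p => (a <= b)%N)
  (fun _ _ => 1%N)) /= (exchange_big_dep xpredT) //=.
transitivity (\sum_(b < p) b.+1)%N.
  apply: eq_bigr => b _; rewrite sum1_card.
  have inj_wid : injective (widen_ord (ltn_ord b)).
    by move=> a c /(congr1 val) /= ac; exact: val_inj.
  rewrite -[RHS]card_ord -(fintype.card_image inj_wid).
  apply: eq_card => a; apply/idP/fintype.imageP => [ab|[c _ ->]]; last first.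
    exact: (ltn_ord c).
  by exists (Ordinal (ab : (a < b.+1)%N)) => //; exact: val_inj.
elim: p => [|p IH]; first by rewrite big_ord0.
by rewrite big_ord_recr /= IH; lia.
Qed.

Lemma trace_vech_vecs (R : realType) (p : nat) (Z H : 'M[R]_p) :
  Z^T = Z -> H^T = H -> (vech Z *m vecs H) 0 0 = \tr (Z *m H).
Proof.
move=> ZT HT.
have Zs a b : Z a b = Z b a by rewrite -[in LHS]ZT mxE.
have Hs a b : H a b = H b a by rewrite -[in LHS]HT mxE.
pose F (ab : 'I_p * 'I_p) : R := Z ab.1 ab.2 * H ab.1 ab.2.
rewrite mxE (eq_bigr (fun l => (fun ab => F ab + if ab.1 != ab.2 then F ab else 0)
  (enum_val l))); last first.
  move=> l _; rewrite !mxE; case: (enum_val l) => a b; rewrite /F /=.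
  by case: eqP => _ /=; ring.
rewrite -(big_enum_val (fun ab => F ab + if ab.1 != ab.2 then F ab else 0)).
rewrite [RHS](_ : _ = \sum_ab F ab); last first.
  rewrite /mxtrace (eq_bigr (fun a => \sum_b F (a, b))) ?pair_bigA; last first.
    by move=> a _; rewrite mxE; apply: eq_bigr => b _; rewrite /F /= (Hs b a).
  by apply: eq_bigr => -[].
rewrite big_split [RHS](bigID (mem (upper p))) /=; congr (_ + _).
rewrite -big_mkcondr (reindex_inj (h := fun ab => (ab.2, ab.1))) /=; last first.
  by move=> [a b] [c e] [-> ->].
apply: eq_big => [[a b]|[a b] _]; last by rewrite /F /= Zs Hs.
change ((b <= a)%N && (b != a) = ~~ (a <= b)%N).
by rewrite -ltnNge ltn_neqAle andbC.
Qed.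

Definition second_moment d (T : measurableType d) (R : realType)
    (P : probability T R) (m : nat) (z : T -> 'cV[R]_m) : 'M[R]_m :=
  \matrix_(a, b) mean P (fun w => z w a 0 * z w b 0).

(* The target d_j(z_t, H) with r := r_j, where (x, u, v) are the components
   of z_t and om is the noise at time t. *)
Definition target (R : realType) (n m1 m2 q1 q2 : nat)
    (S : plant R n m1 m2 q1 q2)
    d (T : measurableType d) (P : probability T R) (om : T -> R)
    (r : (T -> 'cV[R]_n) -> (T -> 'cV[R]_m1) -> (T -> 'cV[R]_m2) -> R)
    (K1 : 'M[R]_(m2, n)) (K2 : 'M[R]_(m1, n)) (H : 'M[R]_(n + m1 + m2))
    (x : T -> 'cV[R]_n) (u : T -> 'cV[R]_m1) (v : T -> 'cV[R]_m2) : R :=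
  r x u v + mean P (fun w => let x' := successor S om x u v w in
                             quad H (stack x' (K2 *m x') (K1 *m x'))).

(* Regression matrices over the window k, ..., k + N. *)
Definition regressor (R : realType) (n m1 m2 : nat)
    d (T : measurableType d) (P : probability T R) (k N : nat)
    (x : nat -> T -> 'cV[R]_n) (u : nat -> T -> 'cV[R]_m1)
    (v : nat -> T -> 'cV[R]_m2) : 'M[R]_(N.+1, #|upper (n + m1 + m2)|) :=
  \matrix_(s < N.+1)
    vech (second_moment P
            (fun w => stack (x (k + s)%N w) (u (k + s)%N w) (v (k + s)%N w))).

Definition response (R : realType) (n m1 m2 q1 q2 : nat)
    (S : plant R n m1 m2 q1 q2)
    d (T : measurableType d) (P : probability T R)
    (omega : nat -> {RV P >-> R})
    (r : (T -> 'cV[R]_n) -> (T -> 'cV[R]_m1) -> (T -> 'cV[R]_m2) -> R)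
    (K1 : 'M[R]_(m2, n)) (K2 : 'M[R]_(m1, n)) (H : 'M[R]_(n + m1 + m2))
    (k N : nat)
    (x : nat -> T -> 'cV[R]_n) (u : nat -> T -> 'cV[R]_m1)
    (v : nat -> T -> 'cV[R]_m2) : 'cV[R]_N.+1 :=
  \col_(s < N.+1) target S P (omega (k + s)%N) r K1 K2 H
                    (x (k + s)%N) (u (k + s)%N) (v (k + s)%N).

Definition least_squares (R : realType) (p N : nat)
    (X : 'M[R]_(N, #|upper p|)) (Y : 'cV[R]_N) (H : 'M[R]_p) : Prop :=
  H^T = H /\ vecs H = invmx (X^T *m X) *m X^T *m Y.

(* A run of the system from the deterministic state x0 in which the probed
   feedback with gains K1, K2 is applied during the window k, ..., k + N;
   before the window the inputs are arbitrary admissible ones. *)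
Record probed_run (R : realType) (n m1 m2 q1 q2 : nat)
    (S : plant R n m1 m2 q1 q2)
    d (T : measurableType d) (P : probability T R)
    (omega : nat -> {RV P >-> R}) (x0 : 'cV[R]_n)
    (eu : nat -> 'cV[R]_m1) (ev : nat -> 'cV[R]_m2)
    (K1 : 'M[R]_(m2, n)) (K2 : 'M[R]_(m1, n)) (k N : nat)
    (x : nat -> T -> 'cV[R]_n) (u : nat -> T -> 'cV[R]_m1)
    (v : nat -> T -> 'cV[R]_m2) : Prop := {
  run_x0 : forall w, x 0%N w = x0;
  run_dynamics : forall t w,
    x t.+1 w = successor S (omega t) (x t) (u t) (v t) w;
  run_before_u : forall t, (t < k)%N -> admissible omega t (u t);
  run_before_v : forall t, (t < k)%N -> admissible omega t (v t);
  run_window_u : forall t w, (k <= t <= k + N)%N ->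
    u t w = K2 *m x t w + eu t;
  run_window_v : forall t w, (k <= t <= k + N)%N ->
    v t w = K1 *m x t w + ev t }.

(* Iteration i uses the run (x i, u i, v i) and the window k i, ..., k i + N.
   One run shared by all iterations, with successive windows, is the case
   where x, u and v do not depend on i. *)
Record probed_iteration (R : realType) (n m1 m2 q1 q2 : nat)
    (S : plant R n m1 m2 q1 q2) (gamma : R)
    d (T : measurableType d) (P : probability T R)
    (omega : nat -> {RV P >-> R}) (x0 : 'cV[R]_n)
    (eu : nat -> 'cV[R]_m1) (ev : nat -> 'cV[R]_m2)
    (K1_0 : 'M[R]_(m2, n)) (K2_0 : 'M[R]_(m1, n))
    (k : nat -> nat) (N : nat)
    (x : nat -> nat -> T -> 'cV[R]_n) (u : nat -> nat -> T -> 'cV[R]_m1)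
    (v : nat -> nat -> T -> 'cV[R]_m2)
    (H1 H2 : nat -> 'M[R]_(n + m1 + m2))
    (K1 : nat -> 'M[R]_(m2, n)) (K2 : nat -> 'M[R]_(m1, n)) : Prop := {
  pr_H1_0 : H1 0%N = 0;
  pr_H2_0 : H2 0%N = 0;
  pr_K1_0 : K1 0%N = K1_0;
  pr_K2_0 : K2 0%N = K2_0;
  pr_run : forall i, probed_run S omega x0 eu ev (K1 i) (K2 i) (k i) N
                       (x i) (u i) (v i);
  pr_excitation : forall i,
    \rank (regressor P (k i) N (x i) (u i) (v i)) = #|upper (n + m1 + m2)|;
  pr_H1 : forall i,
    least_squares (regressor P (k i) N (x i) (u i) (v i))
      (response S omega (r1 S gamma P) (K1 i) (K2 i) (H1 i) (k i) N
         (x i) (u i) (v i)) (H1 i.+1);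
  pr_H2 : forall i,
    least_squares (regressor P (k i) N (x i) (u i) (v i))
      (response S omega (r2 S P) (K1 i) (K2 i) (H2 i) (k i) N
         (x i) (u i) (v i)) (H2 i.+1);
  pr_K : forall i, gain_update (H1 i.+1) (H2 i.+1) (K1 i.+1) (K2 i.+1) }.

(* Main.v *)
(* The window inputs are affine in the state with deterministic coefficients,
   and the state is built from the inputs and the noise before time t, so
   (x_t, u_t, v_t) is square integrable and independent of omega_t, whatever
   the probing noise.  Independence makes the terms of the successor cost that
   are linear in omega_t average to zero, and replaces omega_t^2 by 1.  Hence
   the Bellman identity, assumed only at deterministic (x, u, v), holds in mean
   along the probed run: each response is Tr(Z_t H) for the noise-free H, the
   regression system Y = X vecs(H) is exact, and least squares returns H. *)

Require Import Defs.
From HB Require Import structures.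
From mathcomp Require Import all_boot all_order all_algebra.
From mathcomp Require Import ring lra.
From mathcomp Require Import all_classical all_reals all_analysis.
From mathcomp Require Import measurable_realfun.

Set Implicit Arguments.
Unset Strict Implicit.
Unset Printing Implicit Defensive.

Import Order.TTheory GRing.Theory Num.Theory.
Local Open Scope classical_set_scope.
Local Open Scope ring_scope.

(** * Independence of the noise from its own past *)

(* past omega t is convertible to <<s noise_events omega t >>. *)
Definition noise_events d (T : measurableType d) (R : realType)
    (P : probability T R) (omega : nat -> {RV P >-> R}) (t : nat) :
    set (set T) :=
  [set A | exists s (B : set R),
     [/\ (s < t)%N, measurable B & A = omega s @^-1` B]].

(** A pi-lambda argument. With [C] the event at time [t], the finite measures sending [A] to the
    probability of [A] meeting [C] and to [P C * P A] agree on finite cylinders by the product rule.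
    Cylinders are stable under intersection and generate the past. *)
Lemma past_indep d (T : measurableType d) (R : realType)
    (P : probability T R) (omega : nat -> {RV P >-> R}) (t : nat)
    (A : set T) (D : set R) :
  mutually_independent omega -> past omega t A -> measurable D ->
  P (A `&` omega t @^-1` D) = (P A * P (omega t @^-1` D))%E.
Proof.
move=> ind pA mD.
pose C := omega t @^-1` D.
have mC : measurable C by rewrite -[C]setTI; exact: measurable_funP.
pose G := [set A : set T | exists2 B : nat -> set R,
  forall j, measurable (B j) &
  A = \bigcap_(j in [set` iota 0 t]) (omega j @^-1` B j)].
have mG A' : G A' -> measurable A'.
  move=> [B mB ->]; apply: fin_bigcap_measurable => // j _.
  by rewrite -[X in measurable X]setTI; exact: measurable_funP.
have GT : G [set: T].
  by exists (fun=> setT) => //; apply/seteqP; split.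
have GI : setI_closed G.
  move=> _ _ [B mB ->] [B' mB' ->]; exists (fun j => B j `&` B' j).
    by move=> j; exact: measurableI.
  by rewrite -bigcapI; apply: eq_bigcapr => j _; rewrite preimage_setI.
have pG : <<s G >> A.
  apply: sub_smallest2r pA; first exact: smallest_sigma_algebra.
  move=> _ [s [B [st mB ->]]].
  (* A single event at time [s] is the cylinder left unconstrained at all other times before [t]. *)
  exists (fun j => if j == s then B else setT).
    by move=> j; case: eqP.
  apply/seteqP; split=> [w Bw j _ /=|w /(_ s)] /=.
    by case: eqP => [->|].
  by rewrite mem_iota /= add0n st eqxx; apply.
have pC0 : 0 <= fine (P C) by exact: fine_ge0.
have fC : (fine (P C))%:E = P C by rewrite fineK // fin_num_measure.
pose m1 : {measure set T -> \bar R} := mrestr P mC.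
pose m2 : {measure set T -> \bar R} := mscale (NngNum pC0) P.
have m2E B : m2 B = (P C * P B)%E by rewrite -fC.
suff: m1 A = m2 A by rewrite m2E muleC.
(* The constant sequence [setT] serves as the exhaustion: it lies in [G], and [m1] is finite on
   it. *)
apply: (g_sigma_algebra_measure_unique G mG (fun=> setT)) => //.
- by apply: bigcup_const; exists 0%N.
- move=> A' GA'; have [B mB A'E] := GA'.
  rewrite m2E /m1 /mrestr A'E.
  (* Intersecting a cylinder with [C] gives a cylinder over [t :: iota 0 t]. The product rule there,
     compared with the one over [iota 0 t], leaves the single extra factor [P C]. *)
  pose B' j := if j == t then D else B j.
  have mB' j : measurable (B' j) by rewrite /B'; case: eqP.
  have tn : (t \in iota 0 t) = false by rewrite mem_iota add0n ltnn andbF.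
  have /(ind (t :: iota 0 t) B') /(_ mB') : uniq (t :: iota 0 t).
    by rewrite /= iota_uniq tn.
  have B'E j : j \in iota 0 t -> B' j = B j.
    by rewrite /B'; case: eqP => // ->; rewrite tn.
  rewrite big_cons {2}/B' eqxx big_seq.
  under eq_bigr => j jt do rewrite (B'E j jt).
  rewrite -big_seq -(ind _ _ (iota_uniq _ _) mB) -/C => <-.
  congr (P _); apply/seteqP; split=> [w [Bw Cw] j /=|w Bw].
    rewrite in_cons => /orP[/eqP ->|jt]; first by rewrite /B' eqxx.
    by rewrite B'E //; exact: Bw.
  split=> [j /= jt|].
    by rewrite -B'E //; apply: Bw; rewrite /= in_cons jt orbT.
  by have := Bw t; rewrite /B' /= in_cons eqxx; apply.
- move=> _; rewrite /m1 /mrestr; apply: le_lt_trans (ltry 1).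
  exact: probability_le1 (measurableI _ _ _ _).
Qed.

(** The joint law of [(X, Y)] and the product of the two laws agree on rectangles, hence are equal.
    Integrability of the product then follows from Tonelli, and the value of its integral from
    Fubini. *)
Lemma indep_integral_prod d (T : measurableType d) (R : realType)
    (P : probability T R) (X Y : T -> R) :
  (forall A B, measurable A -> measurable B ->
     P (X @^-1` A `&` Y @^-1` B) = (P (X @^-1` A) * P (Y @^-1` B))%E) ->
  P.-integrable setT (EFin \o X) -> P.-integrable setT (EFin \o Y) ->
  P.-integrable setT (EFin \o (X \* Y)) /\
  (\int[P]_w ((X \* Y) w)%:E =
   \int[P]_w (X w)%:E * \int[P]_w (Y w)%:E)%E.
Proof.
move=> ind iX iY.
have mX : measurable_fun setT X by apply/measurable_EFinP/(measurable_int P).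
have mY : measurable_fun setT Y by apply/measurable_EFinP/(measurable_int P).
pose X' : {RV P >-> R} := HB.pack X (isMeasurableFun.Build _ _ _ _ _ mX).
pose Y' : {RV P >-> R} := HB.pack Y (isMeasurableFun.Build _ _ _ _ _ mY).
have mXY : measurable_fun setT (fun w => (X w, Y w)).
  exact: measurable_fun_pair.
pose XY : {RV P >-> (R * R)%type} :=
  HB.pack (fun w => (X w, Y w)) (isMeasurableFun.Build _ _ _ _ _ mXY).
pose m1 := distribution P X'.
pose m2 := distribution P Y'.
have prodE := product_measure_unique (m1 := m1) (m2 := m2)
  (m' := distribution P XY) ind.
pose f : R * R -> \bar R := fun z => (z.1 * z.2)%:E.
have mf : measurable_fun setT f.
  apply/measurable_EFinP; apply: measurable_funM.
    exact: measurable_fst.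
  exact: measurable_snd.
have i1 : m1.-integrable setT (EFin \o id).
  by apply: integrable_pushforward => //; exact/measurable_EFinP.
have i2 : m2.-integrable setT (EFin \o id).
  by apply: integrable_pushforward => //; exact/measurable_EFinP.
have e1 : (\int[m1]_x x%:E = \int[P]_w (X w)%:E)%E.
  by rewrite integral_distribution //; exact/measurable_EFinP.
have e2 : (\int[m2]_x x%:E = \int[P]_w (Y w)%:E)%E.
  by rewrite integral_distribution //; exact/measurable_EFinP.
have mabs : measurable_fun setT (fun y : R => `|y|%:E).
  by apply/measurable_EFinP; exact: normr_measurable.
have if12 : (m1 \x m2)%E.-integrable setT f.
  apply/integrable12ltyP => //=.
  under eq_integral => x _.
    under eq_integral => y _ do rewrite /f /= normrM EFinM.
    rewrite ge0_integralZl //.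
    over.
  have /integrableP[_ h1] := i1; have /integrableP[_ h2] := i2.
  rewrite ge0_integralZr //.
  - apply: lte_mul_pinfty => //; first exact: integral_ge0.
    by rewrite ge0_fin_numE // integral_ge0.
  - exact: integral_ge0.
(* Integrability is carried from the product law to the joint law, and from there back to the sample
   space. *)
have ifXY : P.-integrable setT (f \o XY).
  apply/integrableP; split; first exact: measurableT_comp.
  have /integrableP[_] := if12.
  rewrite (eq_measure_integral (distribution P XY)) //; last first.
    by move=> A mA _; exact: prodE.
  rewrite ge0_integral_distribution //.
  exact: measurableT_comp.
split=> //.
rewrite -e1 -e2.
have -> : (\int[P]_w ((X \* Y) w)%:E = \int[distribution P XY]_z f z)%E.
  by rewrite integral_distribution.
rewrite (eq_measure_integral (m1 \x m2)%E); last first.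
  by move=> A mA _; exact/esym/prodE.
rewrite -integral12_prod_meas1 // /fubini_F /f /=.
under eq_integral => x _.
  under eq_integral => y _ do rewrite EFinM.
  rewrite integralZl //; over.
(* The inner integral is finite, so it can be written as a real constant and pulled out of the outer
   one. *)
have /fineK <- : (\int[m2]_y y%:E)%E \is a fin_num.
  exact: integrable_fin_num.
by rewrite integralZr.
Qed.

(** * Integrable and square integrable functions of the past noise *)

Section PastVariables.
Context d (T : measurableType d) (R : realType) (P : probability T R).
Context (omega : nat -> {RV P >-> R}).
Implicit Types (t : nat) (X Y : T -> R).

Definition past_measurable t X :=
  forall B : set R, measurable B -> past omega t (X @^-1` B).

Let past_type t := g_sigma_algebraType (noise_events omega t).

(** Viewing the past as the sigma-algebra of a measurable type gives access to the usual closure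
    properties of measurable functions. *)
Lemma past_measurableP t X :
  past_measurable t X <-> measurable_fun [set: past_type t] X.
Proof.
split=> [pX _ B mB|mX B mB]; first by rewrite setTI; exact: pX.
by rewrite -[X in past _ _ X]setTI; exact: mX.
Qed.

Lemma past_measurable_cst t c : past_measurable t (fun=> c).
Proof. by apply/past_measurableP; exact: measurable_cst. Qed.

Lemma past_measurableD t X Y : past_measurable t X -> past_measurable t Y ->
  past_measurable t (fun w => X w + Y w).
Proof.
move=> /past_measurableP pX /past_measurableP pY.
by apply/past_measurableP; exact: measurable_funD.
Qed.

Lemma past_measurableM t X Y : past_measurable t X -> past_measurable t Y ->
  past_measurable t (fun w => X w * Y w).
Proof.
move=> /past_measurableP pX /past_measurableP pY.
by apply/past_measurableP; exact: measurable_funM.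
Qed.

Lemma past_measurableS t X : past_measurable t X -> past_measurable t.+1 X.
Proof.
move=> pX B /pX; apply: sub_smallest2r; first exact: smallest_sigma_algebra.
move=> A [s [C [st mC AE]]].
by exists s, C; split=> //; exact: ltnW.
Qed.

Lemma past_measurable_noise t : past_measurable t.+1 (omega t).
Proof. by move=> B mB; apply: sub_gen_smallest; exists t, B. Qed.

Lemma past_measurableW t X : past_measurable t X -> measurable_fun setT X.
Proof.
move=> pX _ B mB; rewrite setTI.
apply: (smallest_sub (@sigma_algebra_measurable _ T)) (pX _ mB).
move=> _ [s [C [_ mC ->]]].
by rewrite -[X in measurable X]setTI; exact: measurable_funP.
Qed.

Definition past_L1 t X :=
  past_measurable t X /\ P.-integrable setT (EFin \o X).

Definition past_L2 t X :=
  past_measurable t X /\ P.-integrable setT (EFin \o (fun w => X w ^+ 2)).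

Lemma mean_cst c : mean P (fun=> c) = c.
Proof. by rewrite /mean expectation_cst. Qed.

Lemma meanD X Y :
  P.-integrable setT (EFin \o X) -> P.-integrable setT (EFin \o Y) ->
  mean P (fun w => X w + Y w) = mean P X + mean P Y.
Proof. by move=> iX iY; rewrite /mean unlock; exact: RintegralD. Qed.

Lemma meanZ c X : P.-integrable setT (EFin \o X) ->
  mean P (fun w => c * X w) = c * mean P X.
Proof. by move=> iX; rewrite /mean unlock; exact: RintegralZl. Qed.

Lemma past_L1_cst t c : past_L1 t (fun=> c).
Proof.
split; first exact: past_measurable_cst.
exact: finite_measure_integrable_cst.
Qed.

Lemma past_L1D t X Y : past_L1 t X -> past_L1 t Y ->
  past_L1 t (fun w => X w + Y w).
Proof.
move=> [mX iX] [mY iY]; split; first exact: past_measurableD.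
exact: (integrableD _ iX iY).
Qed.

Lemma past_L1Z t c X : past_L1 t X -> past_L1 t (fun w => c * X w).
Proof.
move=> [mX iX]; split.
  by apply: past_measurableM => //; exact: past_measurable_cst.
exact: (integrableZl _ c iX).
Qed.

(** Both conclusions share one induction, because splitting the mean of a sum requires the partial
    sum to be integrable. *)
Lemma past_L1_sum t I (s : seq I) (F : I -> T -> R) :
  (forall i, past_L1 t (F i)) ->
  past_L1 t (fun w => \sum_(i <- s) F i w) /\
  mean P (fun w => \sum_(i <- s) F i w) = \sum_(i <- s) mean P (F i).
Proof.
move=> LF; elim: s => [|i s [Ls IH]].
  under eq_fun do rewrite big_nil.
  by rewrite big_nil mean_cst; split=> //; exact: past_L1_cst.
under eq_fun do rewrite big_cons.
split; first exact: past_L1D.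
by rewrite big_cons meanD ?IH //; [case: (LF i) | case: Ls].
Qed.

(** Domination: [|X Y| <= X ^+ 2 + Y ^+ 2]. *)
Lemma past_L2M t X Y : past_L2 t X -> past_L2 t Y ->
  past_L1 t (fun w => X w * Y w).
Proof.
move=> [mX iX] [mY iY].
have mXY := past_measurableM mX mY; split=> //.
apply: (le_integrable _ _ _ (integrableD _ iX iY)) => //.
  by apply/measurable_EFinP; exact: past_measurableW mXY.
move=> w _ /=; rewrite lee_fin (ger0_norm (addr_ge0 (sqr_ge0 _) (sqr_ge0 _))).
by rewrite ler_norml; apply/andP; split; nra.
Qed.

Lemma past_L2_cst t c : past_L2 t (fun=> c).
Proof.
split; first exact: past_measurable_cst.
exact: finite_measure_integrable_cst.
Qed.

Lemma past_L2D t X Y : past_L2 t X -> past_L2 t Y ->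
  past_L2 t (fun w => X w + Y w).
Proof.
move=> LX LY; have [_ iXY] := past_L2M LX LY.
have [[mX iX] [mY iY]] := (LX, LY); split; first exact: past_measurableD.
(* The square of the sum is regrouped as [(X ^+ 2 + Y ^+ 2) + (X Y + X Y)]. *)
have := integrableD measurableT (integrableD measurableT iX iY)
          (integrableD measurableT iXY iXY).
apply: eq_integrable => // w _ /=; congr EFin; ring.
Qed.

Lemma past_L2Z t c X : past_L2 t X -> past_L2 t (fun w => c * X w).
Proof.
move=> [mX iX]; split.
  by apply: past_measurableM => //; exact: past_measurable_cst.
have := integrableZl measurableT (c ^+ 2) iX.
by apply: eq_integrable => // w _ /=; rewrite exprMn.
Qed.

Lemma past_L2_sum t I (s : seq I) (F : I -> T -> R) :
  (forall i, past_L2 t (F i)) -> past_L2 t (fun w => \sum_(i <- s) F i w).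
Proof.
move=> LF; elim: s => [|i s Ls].
  by under eq_fun do rewrite big_nil; exact: past_L2_cst.
by under eq_fun do rewrite big_cons; exact: past_L2D.
Qed.

Lemma past_L2S t X : past_L2 t X -> past_L2 t.+1 X.
Proof. by move=> [mX iX]; split=> //; exact: past_measurableS. Qed.

Lemma past_L2_admissible t m (y : T -> 'cV[R]_m) : admissible omega t y ->
  forall a, past_L2 t (fun w => y w a 0).
Proof.
move=> ady a; have [my y2] := ady a; split=> //.
apply/integrableP; split.
  apply/measurable_EFinP.
  exact: past_measurableW (past_measurableM my my).
move: y2; rewrite unlock; congr (_ < _)%E; apply: eq_integral => w _ /=.
by rewrite ger0_norm // sqr_ge0.
Qed.

(** * Moments of the current noise against past variables *)

Hypothesis omega_white : white_noise omega.

Lemma noise_sq_integrable t :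
  P.-integrable setT (EFin \o (fun w => omega t w ^+ 2)) /\
  (\int[P]_w (omega t w ^+ 2)%:E)%E = 1%E.
Proof.
have [_ _ /(_ t t)] := omega_white; rewrite eqxx unlock => E; split=> //.
apply/integrableP; split.
  by apply/measurable_EFinP; apply: measurable_funX; exact: measurable_funP.
rewrite (_ : \int[P]_w _ = 1)%E ?ltry //.
rewrite -[RHS]E; apply: eq_integral => w _ /=.
by rewrite ger0_norm // sqr_ge0.
Qed.

(** The first moment is dominated through [|omega t w| <= 1 + omega t w ^+ 2]. *)
Lemma noise_integrable t : P.-integrable setT (EFin \o omega t).
Proof.
have [i2 _] := noise_sq_integrable t.
apply: (le_integrable _ _ _
  (integrableD _ (finite_measure_integrable_cst P 1 measurableT) i2)) => //.
  by apply/measurable_EFinP; exact: measurable_funP.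
move=> w _ /=; rewrite lee_fin (ger0_norm (addr_ge0 ler01 (sqr_ge0 _))).
by rewrite ler_norml; apply/andP; split; nra.
Qed.

(** Independence factors the mean, and the noise factor has mean zero; integrability of the product
    comes from the same factorization. *)
Lemma noise_mul_past t X : past_L1 t X ->
  P.-integrable setT (EFin \o (fun w => omega t w * X w)) /\
  mean P (fun w => omega t w * X w) = 0.
Proof.
move=> [mX iX]; have [ind /(_ t) E0 _] := omega_white.
have [] := @indep_integral_prod _ _ _ P X (omega t) _ iX (noise_integrable t).
  by move=> A B mA mB; exact: (past_indep ind (mX _ mA) mB).
have -> : X \* omega t = (fun w => omega t w * X w).
  by apply/funext => w /=; rewrite mulrC.
move=> i E; split=> //.
by rewrite /mean unlock E; move: E0; rewrite unlock => ->; rewrite mule0.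
Qed.

Lemma noise_sq_mul_past t X : past_L1 t X ->
  P.-integrable setT (EFin \o (fun w => omega t w ^+ 2 * X w)) /\
  mean P (fun w => omega t w ^+ 2 * X w) = mean P X.
Proof.
move=> [mX iX]; have [ind _ _] := omega_white.
have [i2 E2] := noise_sq_integrable t.
have [] := @indep_integral_prod _ _ _ P X (fun w => omega t w ^+ 2) _ iX i2.
  move=> A B mA mB.
  (* Events of the squared noise are events of the noise itself, so independence from the past
     carries over to the square. *)
  have mB' : measurable ((fun y : R => y ^+ 2) @^-1` B).
    by rewrite -[X in measurable X]setTI; exact: measurable_funX.
  exact: (past_indep ind (mX _ mA) mB').
have -> : X \* (fun w => omega t w ^+ 2) = (fun w => omega t w ^+ 2 * X w).
  by apply/funext => w /=; rewrite mulrC.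
by move=> i E; split=> //; rewrite /mean unlock E E2 mule1.
Qed.

(** Multiplying by the current noise stays square integrable, since the squared noise is independent
    of [X ^+ 2], but the result is known only one time step later. *)
Lemma past_L2_noise t X :
  past_L2 t X -> past_L2 t.+1 (fun w => omega t w * X w).
Proof.
move=> LX; have [mX _] := LX; split.
  apply: past_measurableM; first exact: past_measurable_noise.
  exact: past_measurableS.
have [i _] := noise_sq_mul_past (past_L2M LX LX).
by apply: eq_integrable i => // w _ /=; rewrite exprMn expr2.
Qed.

End PastVariables.

(** * Quadratic forms, Gram matrices and exact least squares *)

Definition bilin (R : realType) (m l : nat) (M : 'M[R]_(m, l))
    (y : 'cV[R]_m) (z : 'cV[R]_l) : R := (y^T *m M *m z) 0 0.

Lemma bilinE (R : realType) (m l : nat) (M : 'M[R]_(m, l)) y z :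
  bilin M y z = \sum_j \sum_i M i j * (y i 0 * z j 0).
Proof.
rewrite /bilin mxE; apply: eq_bigr => j _; rewrite mxE mulr_suml.
by apply: eq_bigr => i _; rewrite mxE; ring.
Qed.

Lemma quad_addZ (R : realType) (m : nat) (M : 'M[R]_m) (y z : 'cV[R]_m) c :
  quad M (y + c *: z)
    = quad M y + (c * (bilin M y z + bilin M z y) + c ^+ 2 * quad M z).
Proof.
rewrite /quad /bilin.
have -> : (y + c *: z)^T = y^T + c *: z^T by rewrite linearD linearZ.
rewrite !mulmxDl !mulmxDr -!scalemxAl -!scalemxAr.
by rewrite !mxE; ring.
Qed.

Lemma quad_value_mx (R : realType) (n m1 m2 : nat) (K1 : 'M[R]_(m2, n))
    (K2 : 'M[R]_(m1, n)) (H : 'M[R]_(n + m1 + m2)) (x : 'cV[R]_n) :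
  quad H (stack x (K2 *m x) (K1 *m x)) = quad (value_mx K1 K2 H) x.
Proof.
set L := row_mx (row_mx 1%:M K2^T) K1^T.
have -> : stack x (K2 *m x) (K1 *m x) = L^T *m x.
  by rewrite !tr_row_mx trmx1 !trmxK !mul_col_mx mul1mx.
by rewrite /quad /value_mx -/L trmx_mul trmxK !mulmxA.
Qed.

(** If a row [v] satisfies [v X^T X = 0], then [v X^T] has zero sum of squares and vanishes; full
    column rank of [X] makes [X^T] row free, so [v = 0]. *)
Lemma gramian_unit (R : realType) (N p : nat) (X : 'M[R]_(N, p)) :
  \rank X = p -> X^T *m X \in unitmx.
Proof.
move=> rX; rewrite -row_free_unit; apply: inj_row_free => v vXX.
have freeX : row_free X^T by rewrite /row_free mxrank_tr rX.
apply: (row_free_inj freeX); rewrite mul0mx.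
have : v *m X^T *m (v *m X^T)^T = 0.
  by rewrite trmx_mul trmxK !mulmxA -(mulmxA v) vXX mul0mx.
move=> /matrixP /(_ 0 0); rewrite !mxE => /eqP.
under eq_bigr => j _ do rewrite [X in _ * X]mxE -expr2.
rewrite psumr_eq0 => [/allP v0|j _]; last exact: sqr_ge0.
apply/matrixP => a j; rewrite ord1 [RHS]mxE.
by have := v0 j (mem_index_enum _); rewrite sqrf_eq0 => /eqP.
Qed.

Lemma vecs_inj (R : realType) (p : nat) (H H' : 'M[R]_p) :
  H^T = H -> H'^T = H' -> vecs H = vecs H' -> H = H'.
Proof.
move=> HT HT' E.
have upE (a b : 'I_p) : (a <= b)%N -> H a b = H' a b.
  move=> ab; have ab' : (a, b) \in upper p by [].
  have /matrixP /(_ (enum_rank_in ab' (a, b)) 0) := E.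
  by rewrite !mxE enum_rankK_in.
apply/matrixP => a b; have [/upE //|/ltnW /upE] := leqP a b.
by rewrite -[in H a b]HT -[in H' a b]HT' !mxE.
Qed.

(** For consistent data, [(X^T X)^-1 X^T] is a left inverse of [X], and symmetry recovers the matrix
    from its upper triangle. *)
Lemma least_squares_exact (R : realType) (p N : nat)
    (X : 'M[R]_(N, #|upper p|)) (H Hhat : 'M[R]_p) :
  \rank X = #|upper p| -> H^T = H -> least_squares X (X *m vecs H) Hhat ->
  Hhat = H.
Proof.
move=> /gramian_unit uX HT [HhatT E]; apply: vecs_inj => //.
by rewrite E mulmxA -(mulmxA _ _ X) mulVmx // mul1mx.
Qed.

Lemma gain_update_inj (R : realType) (n m1 m2 : nat)
    (H1 H2 : 'M[R]_(n + m1 + m2)) (K1 K1' : 'M[R]_(m2, n))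
    (K2 K2' : 'M[R]_(m1, n)) :
  gain_update H1 H2 K1 K2 -> gain_update H1 H2 K1' K2' ->
  K1 = K1' /\ K2 = K2'.
Proof. by move=> [_ E] [_]; rewrite -E => /eq_col_mx[-> ->]. Qed.

(** * The Bellman identity along non-anticipating inputs *)

Section Bellman.
Context d (T : measurableType d) (R : realType) (P : probability T R).
Context (omega : nat -> {RV P >-> R}).
Context (n m1 m2 q1 q2 : nat) (S : plant R n m1 m2 q1 q2).

Definition past_L2v t m (y : T -> 'cV[R]_m) :=
  forall a, past_L2 omega t (fun w => y w a 0).

Lemma past_L2v_cst t m (y : 'cV[R]_m) : past_L2v t (fun=> y).
Proof. by move=> a; exact: past_L2_cst. Qed.

Lemma past_L2v_mul t m l (M : 'M[R]_(l, m)) y :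
  past_L2v t y -> past_L2v t (fun w => M *m y w).
Proof.
move=> Ly a; under eq_fun do rewrite mxE.
by apply: past_L2_sum => j; exact: past_L2Z.
Qed.

Lemma past_L2vD t m (y z : T -> 'cV[R]_m) :
  past_L2v t y -> past_L2v t z -> past_L2v t (fun w => y w + z w).
Proof. by move=> Ly Lz a; under eq_fun do rewrite mxE; exact: past_L2D. Qed.

Lemma past_L2v_stack t (x : T -> 'cV[R]_n) (u : T -> 'cV[R]_m1)
    (v : T -> 'cV[R]_m2) :
  past_L2v t x -> past_L2v t u -> past_L2v t v ->
  past_L2v t (fun w => stack (x w) (u w) (v w)).
Proof.
move=> Lx Lu Lv a; under eq_fun do rewrite mxE.
case: (fintype.split a) => [b|b]; last exact: Lv.
under eq_fun do rewrite mxE.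
by case: (fintype.split b) => c; [exact: Lx | exact: Lu].
Qed.

Lemma past_L1_bilin t m l (M : 'M[R]_(m, l)) y z :
  past_L2v t y -> past_L2v t z ->
  past_L1 omega t (fun w => bilin M (y w) (z w)) /\
  mean P (fun w => bilin M (y w) (z w))
    = \sum_j \sum_i M i j * mean P (fun w => y w i 0 * z w j 0).
Proof.
move=> Ly Lz; under eq_fun do rewrite bilinE.
have Lyz i j := past_L2M (Ly i) (Lz j).
have LM j := past_L1_sum (index_enum 'I_m)
  (fun i => past_L1Z (M i j) (Lyz i j)).
have [LMs ->] := past_L1_sum (index_enum 'I_l) (fun j => (LM j).1).
split=> //; apply: eq_bigr => j _; rewrite (LM j).2.
by apply: eq_bigr => i _; rewrite meanZ //; case: (Lyz i j).
Qed.

Lemma past_L1_quad t m (M : 'M[R]_m) y :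
  past_L2v t y -> past_L1 omega t (fun w => quad M (y w)).
Proof. by move=> Ly; have [] := past_L1_bilin M Ly Ly. Qed.

(** The link to the regression: a quadratic form is seen in mean only through the second moment
    matrix, which is what a row of the regressor encodes. *)
Lemma mean_quad t m (M : 'M[R]_m) y : past_L2v t y ->
  mean P (fun w => quad M (y w)) = \tr (second_moment P y *m M).
Proof.
move=> Ly; have [_ ->] := past_L1_bilin M Ly Ly.
apply: eq_bigr => j _; rewrite mxE; apply: eq_bigr => i _.
rewrite mxE mulrC; congr (mean P _ * _); apply/funext => w; exact: mulrC.
Qed.

(** The successor is [drift + omega t *: diffusion], where both coefficients depend on the past
    only. *)
Let drift (x : 'cV[R]_n) (u : 'cV[R]_m1) (v : 'cV[R]_m2) :=
  A1 S *m x + B1 S *m u + C1 S *m v.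

Let diffusion (x : 'cV[R]_n) (v : 'cV[R]_m2) := A2 S *m x + C2 S *m v.

Let past_L2v_drift t x u v :
  past_L2v t x -> past_L2v t u -> past_L2v t v ->
  past_L2v t (fun w => drift (x w) (u w) (v w)).
Proof.
move=> Lx Lu Lv; apply: past_L2vD; last exact: past_L2v_mul.
by apply: past_L2vD; exact: past_L2v_mul.
Qed.

Let past_L2v_diffusion t x v : past_L2v t x -> past_L2v t v ->
  past_L2v t (fun w => diffusion (x w) (v w)).
Proof. by move=> *; apply: past_L2vD; exact: past_L2v_mul. Qed.

Hypothesis omega_white : white_noise omega.

Lemma past_L2v_successor t x u v :
  past_L2v t x -> past_L2v t u -> past_L2v t v ->
  past_L2v t.+1 (successor S (omega t) x u v).
Proof.
move=> Lx Lu Lv; apply: past_L2vD => a.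
  exact/past_L2S/past_L2v_drift.
under eq_fun do rewrite mxE.
by apply: past_L2_noise => //; exact: past_L2v_diffusion.
Qed.

Lemma mean_quad_successor t (M : 'M[R]_n) x u v :
  past_L2v t x -> past_L2v t u -> past_L2v t v ->
  mean P (fun w => quad M (successor S (omega t) x u v w))
    = mean P (fun w => quad M (drift (x w) (u w) (v w)))
      + mean P (fun w => quad M (diffusion (x w) (v w))).
Proof.
move=> Lx Lu Lv.
have Lf := past_L2v_drift Lx Lu Lv; have Lg := past_L2v_diffusion Lx Lv.
under [in LHS]eq_fun do rewrite quad_addZ.
have [Lff Lgg] := (past_L1_quad M Lf, past_L1_quad M Lg).
have [[Lfg _] [Lgf _]] := (past_L1_bilin M Lf Lg, past_L1_bilin M Lg Lf).
have [i1 E1] := noise_mul_past omega_white (past_L1D Lfg Lgf).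
have [i2 E2] := noise_sq_mul_past omega_white Lgg.
rewrite meanD ?(meanD i1 i2) ?E1 ?E2 ?add0r //; first by case: Lff.
exact: integrableD i1 i2.
Qed.

(** Both stage costs are means of block diagonal quadratic forms; abstract weights allow one
    argument to cover [r1] and [r2]. *)
Context (r : (T -> 'cV[R]_n) -> (T -> 'cV[R]_m1) -> (T -> 'cV[R]_m2) -> R).
Context (W1 : 'M[R]_n) (W2 : 'M[R]_m1) (W3 : 'M[R]_m2).
Hypothesis rE : forall x u v,
  r x u v = mean P (fun w => quad W1 (x w) + (quad W2 (u w) + quad W3 (v w))).

(* Deterministic arguments turn the averaged Bellman identity into a pointwise
   one, which can be integrated back along any square integrable input that
   does not anticipate the noise. *)
Lemma bellman_past t Pm H x u v :
  bellman_update S omega r Pm H ->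
  past_L2v t x -> past_L2v t u -> past_L2v t v ->
  Qfun P H x u v
    = r x u v + mean P (fun w => quad Pm (successor S (omega t) x u v w)).
Proof.
move=> [_ bell] Lx Lu Lv.
have bellE x0 u0 v0 : quad H (stack x0 u0 v0)
    = quad W1 x0 + (quad W2 u0 + quad W3 v0)
      + (quad Pm (drift x0 u0 v0) + quad Pm (diffusion x0 v0)).
  have := bell t x0 u0 v0; rewrite /Qfun rE !mean_cst => ->.
  by rewrite mean_quad_successor ?mean_cst //; exact: past_L2v_cst.
rewrite mean_quad_successor // rE /Qfun; under eq_fun do rewrite bellE.
have [_ iW] := past_L1D (past_L1_quad W1 Lx)
  (past_L1D (past_L1_quad W2 Lu) (past_L1_quad W3 Lv)).
have [_ if_] := past_L1_quad Pm (past_L2v_drift Lx Lu Lv).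
have [_ ig] := past_L1_quad Pm (past_L2v_diffusion Lx Lv).
by rewrite meanD ?(meanD if_ ig) //; exact: integrableD if_ ig.
Qed.

(** Each row of the product is the trace of the second moment matrix times [H'], that is, the
    Q-function at that time; the Bellman identity turns it into the target, whose stacked next state
    under the gains yields the form [value_mx K1 K2 H]. *)
Lemma response_exact K1 K2 H H' k N x u v :
  bellman_update S omega r (value_mx K1 K2 H) H' ->
  (forall t, (k <= t <= k + N)%N ->
     [/\ past_L2v t (x t), past_L2v t (u t) & past_L2v t (v t)]) ->
  response S omega r K1 K2 H k N x u v = regressor P k N x u v *m vecs H'.
Proof.
move=> bell L2; apply/matrixP => s j; rewrite ord1 {j}.
have [|Lx Lu Lv] := L2 (k + s)%N.
  by rewrite leq_addr leq_add2l -ltnS ltn_ord.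
have [HT _] := bell.
have -> : (regressor P k N x u v *m vecs H') s 0
    = (row s (regressor P k N x u v) *m vecs H') 0 0.
  by rewrite -row_mul [RHS]mxE.
(* The trace formula requires the second moment matrix to be symmetric. *)
rewrite rowK trace_vech_vecs //; last first.
  apply/matrixP => a b; rewrite !mxE; congr (mean P _).
  by apply/funext => w; exact: mulrC.
rewrite -(mean_quad _ (past_L2v_stack Lx Lu Lv)).
have := bellman_past bell Lx Lu Lv; rewrite /Qfun => ->.
rewrite mxE /target; congr (_ + mean P _).
by apply/funext => w /=; rewrite quad_value_mx.
Qed.

End Bellman.

(** * Exactness of the estimates along a probed run *)

(** Induction on time: the state starts deterministic, the inputs are admissible or affine in the
    current state, and each transition adds one noise variable to the past. *)
Lemma probed_run_past_L2v (R : realType) (n m1 m2 q1 q2 : nat)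
    (S : plant R n m1 m2 q1 q2)
    d (T : measurableType d) (P : probability T R)
    (omega : nat -> {RV P >-> R}) (x0 : 'cV[R]_n)
    (eu : nat -> 'cV[R]_m1) (ev : nat -> 'cV[R]_m2)
    (K1 : 'M[R]_(m2, n)) (K2 : 'M[R]_(m1, n)) (k N : nat)
    (x : nat -> T -> 'cV[R]_n) (u : nat -> T -> 'cV[R]_m1)
    (v : nat -> T -> 'cV[R]_m2) :
  white_noise omega -> probed_run S omega x0 eu ev K1 K2 k N x u v ->
  forall t, (t <= k + N)%N ->
  [/\ past_L2v omega t (x t), past_L2v omega t (u t) & past_L2v omega t (v t)].
Proof.
move=> wh [ex0 dyn bu bv wu wv] t tN.
(* Separated from the induction because it serves twice: in the transition to the next state and for
   the inputs at the final time. *)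
have inputs s : (s <= k + N)%N -> past_L2v omega s (x s) ->
    past_L2v omega s (u s) /\ past_L2v omega s (v s).
  move=> sN Lx; have [sk|ks] := ltnP s k.
    by split; apply: past_L2_admissible; [exact: bu | exact: bv].
  have win : (k <= s <= k + N)%N by rewrite ks.
  have -> : u s = (fun w => K2 *m x s w + eu s).
    by apply/funext => w; exact: wu.
  have -> : v s = (fun w => K1 *m x s w + ev s).
    by apply/funext => w; exact: wv.
  by split; apply: past_L2vD;
    [exact: past_L2v_mul|exact: past_L2v_cst|
     exact: past_L2v_mul|exact: past_L2v_cst].
suff Lx : past_L2v omega t (x t) by have [] := inputs t tN Lx.
elim: t tN => [|t IH] tN.
  have -> : x 0%N = (fun=> x0) by apply/funext => w; exact: ex0.
  exact: past_L2v_cst.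
have Lx := IH (ltnW tN); have [Lu Lv] := inputs t (ltnW tN) Lx.
have -> : x t.+1 = successor S (omega t) (x t) (u t) (v t).
  by apply/funext => w; exact: dyn.
exact: past_L2v_successor.
Qed.

Lemma probed_estimate_exact (R : realType) (n m1 m2 q1 q2 : nat)
    (S : plant R n m1 m2 q1 q2)
    d (T : measurableType d) (P : probability T R)
    (omega : nat -> {RV P >-> R}) (x0 : 'cV[R]_n)
    (eu : nat -> 'cV[R]_m1) (ev : nat -> 'cV[R]_m2)
    (K1 : 'M[R]_(m2, n)) (K2 : 'M[R]_(m1, n)) (k N : nat)
    (x : nat -> T -> 'cV[R]_n) (u : nat -> T -> 'cV[R]_m1)
    (v : nat -> T -> 'cV[R]_m2)
    (r : (T -> 'cV[R]_n) -> (T -> 'cV[R]_m1) -> (T -> 'cV[R]_m2) -> R)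
    (W1 : 'M[R]_n) (W2 : 'M[R]_m1) (W3 : 'M[R]_m2)
    (H H' Hhat : 'M[R]_(n + m1 + m2)) :
  (forall x u v,
     r x u v
       = mean P (fun w => quad W1 (x w) + (quad W2 (u w) + quad W3 (v w)))) ->
  white_noise omega -> probed_run S omega x0 eu ev K1 K2 k N x u v ->
  \rank (regressor P k N x u v) = #|upper (n + m1 + m2)| ->
  bellman_update S omega r (value_mx K1 K2 H) H' ->
  least_squares (regressor P k N x u v)
    (response S omega r K1 K2 H k N x u v) Hhat ->
  Hhat = H'.
Proof.
move=> rE wh run rk bell; have [HT _] := bell.
rewrite (response_exact wh rE bell) => [|t /andP[_ tN]].
  exact: least_squares_exact.
exact: probed_run_past_L2v run t tN.
Qed.

Lemma quad_scalar (R : realType) (m : nat) (c : R) (z : 'cV[R]_m) :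
  quad c%:M z = c * (z^T *m z) 0 0.
Proof. by rewrite /quad mul_mx_scalar -scalemxAl mxE. Qed.

Lemma r1_quad (R : realType) (n m1 m2 q1 q2 : nat)
    (S : plant R n m1 m2 q1 q2) (gamma : R)
    d (T : measurableType d) (P : probability T R) x u v :
  r1 S gamma P x u v
    = mean P (fun w => quad (- Qmx S) (x w)
        + (quad (-1)%:M (u w) + quad (gamma ^+ 2)%:M (v w))).
Proof.
congr (mean P _); apply/funext => w; rewrite !quad_scalar.
have -> : quad (- Qmx S) (x w) = - quad (Qmx S) (x w).
  by rewrite /quad mulmxN mulNmx mxE.
by ring.
Qed.

Lemma r2_quad (R : realType) (n m1 m2 q1 q2 : nat)
    (S : plant R n m1 m2 q1 q2)
    d (T : measurableType d) (P : probability T R) x u v :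
  r2 S P x u v
    = mean P (fun w => quad (Qmx S) (x w)
        + (quad 1%:M (u w) + quad (0 : R)%:M (v w) : R)).
Proof.
by congr (mean P _); apply/funext => w; rewrite !quad_scalar mul1r mul0r addr0.
Qed.

Theorem theorem1 (R : realType)
    (d : measure_display) (T : measurableType d) (P : probability T R)
    (n m1 m2 q1 q2 : nat) (S : plant R n m1 m2 q1 q2) (gamma : R)
    (omega : nat -> {RV P >-> R}) (x0 : 'cV[R]_n)
    (K1_0 : 'M[R]_(m2, n)) (K2_0 : 'M[R]_(m1, n))
    (H1 H2 : nat -> 'M[R]_(n + m1 + m2))
    (K1 : nat -> 'M[R]_(m2, n)) (K2 : nat -> 'M[R]_(m1, n))
    (eu : nat -> 'cV[R]_m1) (ev : nat -> 'cV[R]_m2)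
    (k : nat -> nat) (N : nat)
    (x : nat -> nat -> T -> 'cV[R]_n) (u : nat -> nat -> T -> 'cV[R]_m1)
    (v : nat -> nat -> T -> 'cV[R]_m2)
    (H1hat H2hat : nat -> 'M[R]_(n + m1 + m2))
    (K1hat : nat -> 'M[R]_(m2, n)) (K2hat : nat -> 'M[R]_(m1, n)) :
  (Dout S)^T *m Dout S = 1%:M ->
  0 < gamma ->
  white_noise omega ->
  noise_free_iteration S gamma omega K1_0 K2_0 H1 H2 K1 K2 ->
  probed_iteration S gamma omega x0 eu ev K1_0 K2_0 k N x u v
    H1hat H2hat K1hat K2hat ->
  forall i : nat, H1hat i = H1 i /\ H2hat i = H2 i.
Proof.
move=> _ _ wh [h10 h20 k10 k20 nfH1 nfH2 nfK]
  [h10' h20' k10' k20' run exc prH1 prH2 prK] i.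
(* The gains enter the induction hypothesis, since the targets and the probed feedback of the next
   iteration depend on them. *)
suff [-> -> _ _] : [/\ H1hat i = H1 i, H2hat i = H2 i,
    K1hat i = K1 i & K2hat i = K2 i] by [].
elim: i => [|i [E1 E2 EK1 EK2]]; first by split; congruence.
have {prH1}/(_ i) ls1 := prH1; have {prH2}/(_ i) ls2 := prH2.
have runi := run i.
(* The targets and the feedback now use the noise-free matrices and gains, while the trajectory
   still carries its probing noise. *)
rewrite E1 EK1 EK2 in ls1; rewrite E2 EK1 EK2 in ls2; rewrite EK1 EK2 in runi.
have EH1 : H1hat i.+1 = H1 i.+1.
  exact: (probed_estimate_exact (r1_quad S gamma P) wh runi (exc i) (nfH1 i)).
have EH2 : H2hat i.+1 = H2 i.+1.
  exact: (probed_estimate_exact (r2_quad S P) wh runi (exc i) (nfH2 i)).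
(* Both gain pairs solve the same update once the two estimated matrices agree with the noise-free
   ones. *)
have := prK i; rewrite EH1 EH2 => /gain_update_inj /(_ (nfK i))[-> ->].
by [].
Qed.
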